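(* Let $\varepsilon'\in(0,1)$, $\eta>0$, and let $\Omega\subset B_R^d\subset\mathbb{R}^d$ be a smooth compact manifold without boundary, of dimension $k\le d$, equipped with an atlas $(\Psi_j,U_j)_{j\in[T]}$ as in the context such that there exists $Q>0$ with $\sup_{u\in B_{r_j}^k}\|D^\alpha\Psi_j^{-1}(u)\|\le Q^{|\alpha|}$ for all nonzero multi-indices $\alpha\in\mathbb{N}_0^k$ and all $j\in[T]$. There exists $c_{\Omega,\eta}>0$, depending only on $\Omega$ (including its atlas, $Q$ and $R$) and $\eta$, and not on $X$, $n$ or $\varepsilon'$, such that for every $n\ge2$ and every set $X\subset\Omega$ of $n$ points, $$r^*(X,\eta,\varepsilon')\le c_{\Omega,\eta}\Big(\log\frac{n}{\varepsilon'}\Big)^{5k/2}.$$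
   Context: $B_\rho^m$ denotes the ball of radius $\rho$ centered at the origin of $\mathbb{R}^m$. Atlas: $T\in\mathbb{N}$; $(U_j)_{j\in[T]}$ are open sets covering $\Omega$, and each $\Psi_j:U_j\to B_{r_j}^k$ is a smooth bijection with smooth inverse. For $X=\{x_1,\dots,x_n\}\subset B_R^d$, let $K_{ij}=e^{-\eta\|x_i-x_j\|_2^2}$ with eigenvalues $\lambda_1(K)\ge\dots\ge\lambda_n(K)$. The effective dimension at level $\tau>0$ is $d_{\mathrm{eff}}(\tau)=\sum_{j=1}^n\frac{\lambda_j(K)}{\lambda_j(K)+\tau n}$, and the approximation rank is $r^*(X,\eta,\varepsilon')=d_{\mathrm{eff}}\big(\frac{\varepsilon'}{2n}e^{-4\eta R^2}\big)$. *)

(* Defs.v *)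
From HB Require Import structures.
From mathcomp Require Import all_boot all_order all_algebra.
From mathcomp Require Import spectral complex.
From mathcomp Require Import all_classical all_reals all_analysis.
Set Implicit Arguments.
Unset Strict Implicit.
Unset Printing Implicit Defensive.
Import Order.TTheory GRing.Theory Num.Theory numFieldNormedType.Exports.
Local Open Scope classical_set_scope.
Local Open Scope ring_scope.

(* The library norm `|x| on 'rV[R]_m is the sup norm, hence this definition.
   Both norms induce the same topology. *)
Definition l2norm {R : realType} {m : nat} (x : 'rV[R]_m) : R :=
  Num.sqrt (\sum_(i < m) x 0 i ^+ 2).

Definition l2ball {R : realType} {m : nat} (rho : R) : set 'rV[R]_m :=
  [set u | l2norm u < rho].

Definition l2cball {R : realType} {m : nat} (rho : R) : set 'rV[R]_m :=
  [set u | l2norm u <= rho].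

Definition pderiv {R : realType} {m p : nat} (i : 'I_m)
    (f : 'rV[R]_m -> 'rV[R]_p) : 'rV[R]_m -> 'rV[R]_p :=
  fun x => 'D_(delta_mx 0 i) f x.

Definition pderivs {R : realType} {m p : nat} (s : seq 'I_m)
    (f : 'rV[R]_m -> 'rV[R]_p) : 'rV[R]_m -> 'rV[R]_p :=
  foldr pderiv f s.

Definition mdegree {m : nat} (alpha : {ffun 'I_m -> nat}) : nat :=
  (\sum_(i < m) alpha i)%N.

(* D^alpha = d_0^(alpha 0) ... d_(m-1)^(alpha (m-1)). *)
Definition mderiv {R : realType} {m p : nat} (alpha : {ffun 'I_m -> nat})
    (f : 'rV[R]_m -> 'rV[R]_p) : 'rV[R]_m -> 'rV[R]_p :=
  pderivs (flatten [seq nseq (alpha i) i | i <- enum 'I_m]) f.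

(* C^oo on V, meant for open V: all iterated partial derivatives, in any
   order, exist and are continuous at each point of V. *)
Definition smooth_open {R : realType} {m p : nat} (V : set 'rV[R]_m)
    (f : 'rV[R]_m -> 'rV[R]_p) : Prop :=
  forall (s : seq 'I_m) (x : 'rV[R]_m), V x ->
    {for x, continuous (pderivs s f)} /\
    (forall i : 'I_m, derivable (pderivs s f) x (delta_mx 0 i)).

(* A map on an arbitrary subset A of R^m is smooth when it extends, near each
   point of A, to a C^oo map on an open set; the values of f outside A are
   irrelevant. If A is open this amounts to smooth_open A f. *)
Definition smooth_on {R : realType} {m p : nat} (A : set 'rV[R]_m)
    (f : 'rV[R]_m -> 'rV[R]_p) : Prop :=
  forall x, A x -> exists (V : set 'rV[R]_m) (F : 'rV[R]_m -> 'rV[R]_p),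
    [/\ open V, V x, smooth_open V F & forall y, (A `&` V) y -> F y = f y].

(* f : A -> B is a smooth bijection whose inverse g : B -> A is smooth. *)
Definition diffeo {R : realType} {m p : nat} (A : set 'rV[R]_m)
    (B : set 'rV[R]_p) (f : 'rV[R]_m -> 'rV[R]_p)
    (g : 'rV[R]_p -> 'rV[R]_m) : Prop :=
  [/\ forall x, A x -> B (f x) /\ g (f x) = x,
      forall u, B u -> A (g u) /\ f (g u) = u,
      smooth_on A f & smooth_on B g].

Definition rel_open {R : realType} {d : nat} (Omega U : set 'rV[R]_d) : Prop :=
  exists2 O : set 'rV[R]_d, open O & U = Omega `&` O.

(* k-dimensional smooth submanifold of R^d without boundary. *)
Definition smooth_manifold {R : realType} {d : nat} (k : nat)
    (Omega : set 'rV[R]_d) : Prop :=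
  forall x, Omega x ->
    exists (U : set 'rV[R]_d) (W : set 'rV[R]_k)
           (f : 'rV[R]_d -> 'rV[R]_k) (g : 'rV[R]_k -> 'rV[R]_d),
      [/\ rel_open Omega U, U x, open W & diffeo U W f g].

(* Psi j is only meaningful on U j, and Psi_inv j on the ball of radius r j. *)
Definition is_atlas {R : realType} {d k T : nat} (Omega : set 'rV[R]_d)
    (U : 'I_T -> set 'rV[R]_d) (r : 'I_T -> R)
    (Psi : 'I_T -> 'rV[R]_d -> 'rV[R]_k)
    (Psi_inv : 'I_T -> 'rV[R]_k -> 'rV[R]_d) : Prop :=
  [/\ Omega `<=` \bigcup_j U j,
      forall j, rel_open Omega (U j),
      forall j, 0 < r j &
      forall j, diffeo (U j) (l2ball (r j)) (Psi j) (Psi_inv j)].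

(* The eigenvalues of A with multiplicity, in nonincreasing order; the default
   is used only when char_poly A does not split over R, see eigenvaluesP. *)
Definition eigenvalues {R : realType} {n : nat} (A : 'M[R]_n) : seq R :=
  xget (nseq n 0) [set s : seq R |
    sorted >=%R s /\ char_poly A = \prod_(l <- s) ('X - l%:P)].

Definition gaussian_kernel {R : realType} {d n : nat} (eta : R)
    (x : 'I_n -> 'rV[R]_d) : 'M[R]_n :=
  \matrix_(i, j) expR (- eta * l2norm (x i - x j) ^+ 2).

Definition effective_dim {R : realType} {n : nat} (K : 'M[R]_n) (tau : R) : R :=
  \sum_(j < n) (eigenvalues K)`_j / ((eigenvalues K)`_j + tau * n%:R).

(* rho is the radius of the ball containing the points. *)
Definition approx_rank {R : realType} {d n : nat} (rho : R)
    (x : 'I_n -> 'rV[R]_d) (eta eps : R) : R :=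
  effective_dim (gaussian_kernel eta x)
    (eps / (2 * n%:R) * expR (- 4 * eta * rho ^+ 2)).

Lemma char_poly_conj {F : fieldType} {n : nat} (P D : 'M[F]_n) :
  P \in unitmx -> char_poly (invmx P *m D *m P) = char_poly D.
Proof.
move=> uP; rewrite /char_poly.
have -> : char_poly_mx (invmx P *m D *m P) =
    map_mx polyC (invmx P) *m char_poly_mx D *m map_mx polyC P.
  rewrite /char_poly_mx mulmxBr mulmxBl; congr (_ - _); last by rewrite !map_mxM.
  rewrite -[X in _ = X]mulmxA -scalar_mxC.
  by rewrite mulmxA -map_mxM mulVmx// map_mx1 mul1mx.
by rewrite !det_mulmx mulrAC -det_mulmx -map_mxM mulVmx// map_mx1 det1 mul1r.
Qed.

Lemma char_poly_split {R : realType} {n : nat} (A : 'M[R]_n) : A^T = A ->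
  exists s : seq R, char_poly A = \prod_(l <- s) ('X - l%:P).
Proof.
move=> symA; pose B : 'M[complex R]_n := map_mx (real_complex R) A.
have realB : B \is a mxOver Num.real.
  by apply/mxOverP => i j; rewrite mxE; apply/complex_realP; exists (A i j).
have hermB : B \is hermsymmx.
  apply: realsym_hermsym => //; apply/is_hermitianmxP.
  by rewrite expr0 scale1r map_mx_id// /B matrix.map_trmx symA.
have /orthomx_spectralP BE := hermitian_normalmx hermB.
have /mxOverP realsp := hermitian_spectral_diag_real hermB.
exists [seq complex.Re (spectral_diag B 0 i) | i <- enum 'I_n].
apply: (@map_poly_inj _ _ (real_complex R)).
rewrite map_char_poly -/B [in LHS]BE char_poly_conj ?spectral_unit//.
rewrite char_poly_trig ?diag_mx_is_trig// big_map big_enum rmorph_prod/=.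
apply: eq_bigr => i _; rewrite rmorphB/= map_polyX map_polyC/= mxE eqxx mulr1n.
by rewrite RRe_real.
Qed.

Lemma eigenvaluesP {R : realType} {n : nat} (A : 'M[R]_n) : A^T = A ->
  [/\ size (eigenvalues A) = n, sorted >=%R (eigenvalues A) &
      char_poly A = \prod_(l <- eigenvalues A) ('X - l%:P)].
Proof.
move=> /char_poly_split[s sE]; pose E := [set t : seq R |
  sorted >=%R t /\ char_poly A = \prod_(l <- t) ('X - l%:P)].
have Es : E (sort >=%R s).
  split; first by apply: sort_sorted => x y; exact: le_total.
  by rewrite sE; apply: perm_big; rewrite perm_sym perm_sort.
have [tsorted tE] := xgetI (nseq n 0) Es; split => //; apply/succn_inj.
by rewrite -(size_char_poly A) tE size_prod_XsubC.
Qed.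

(* Main.v *)
Require Import Defs.
From HB Require Import structures.
From mathcomp Require Import all_boot all_order all_algebra.
From mathcomp Require Import spectral complex ring lra.
From mathcomp Require Import all_classical all_reals all_analysis.
Set Implicit Arguments.
Unset Strict Implicit.
Unset Printing Implicit Defensive.
Import Order.TTheory GRing.Theory Num.Theory numFieldNormedType.Exports.
Local Open Scope classical_set_scope.
Local Open Scope ring_scope.

(* The bounds Q^|alpha| carry no factorial, so on each chart the Taylor
   polynomial of degree about N of Psi_j^-1 at the origin is accurate up to
   O(2^-N). Substituting it into the exponential series truncated at order N
   approximates u |-> exp(-eta |Psi_j^-1(u) - y|^2), uniformly in y and up to
   O(2^-N), by a polynomial in u of degree O(N^2) in each of the k variables.
   Hence the kernel matrix is within O(2^-N) entrywise of a (non-symmetric)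
   matrix of rank O(N^(2k)). By Weyl's argument at most that many eigenvalues
   exceed n O(2^-N), and these contribute at most 1 each to the effective
   dimension. Taking N proportional to log(n / eps) makes the total contribution
   of the other eigenvalues at most 1, which gives the exponent 2k <= 5k/2. *)

(** * Quadratic forms and spectra of matrices close to low rank *)

Definition qform {R : realType} {n : nat} (A : 'M[R]_n) (v : 'I_n -> R) : R :=
  \sum_i \sum_j A i j * (v i * v j).

(** Orthogonality of [v] to every [a _ m] leaves only the error matrix in the form, and [v i * v j]
    is at most the mean of the two squares. Annihilation on one side is enough, which allows for a
    non-symmetric approximant. *)
Lemma qform_low_rank_le (R : realType) (n : nat) (A : 'M[R]_n) (I : finType)
    (a : 'I_n -> I -> R) (b : I -> 'I_n -> R) (delta : R) (v : 'I_n -> R) :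
  (forall i j, `|A i j - \sum_m a i m * b m j| <= delta) ->
  (forall m, \sum_i v i * a i m = 0) ->
  qform A v <= n%:R * delta * \sum_i v i ^+ 2.
Proof.
move=> Ale va0.
have -> : qform A v =
    \sum_i \sum_j (A i j - \sum_m a i m * b m j) * (v i * v j).
  rewrite /qform; under [RHS]eq_bigr do under eq_bigr do rewrite mulrBl.
  under [RHS]eq_bigr do rewrite sumrB.
  rewrite sumrB; suff -> : \sum_i \sum_j (\sum_m a i m * b m j) * (v i * v j) = 0.
    by rewrite subr0.
  rewrite exchange_big big1// => j _.
  under eq_bigr do rewrite mulr_suml.
  rewrite exchange_big big1// => m _.
  transitivity ((\sum_i v i * a i m) * (b m j * v j)); last by rewrite va0 mul0r.
  by rewrite mulr_suml; apply: eq_bigr => i _; ring.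
have -> : n%:R * delta * \sum_i v i ^+ 2 =
    \sum_i \sum_j delta * (v i ^+ 2 + v j ^+ 2) / 2.
  transitivity (\sum_i (delta / 2 * (n%:R * v i ^+ 2 + \sum_j v j ^+ 2))).
    rewrite -mulr_sumr big_split/= -mulr_sumr sumr_const card_ord -[_ *+ n]mulr_natl.
    by field.
  apply: eq_bigr => i _; under [RHS]eq_bigr do rewrite mulrAC.
  by rewrite -[RHS]mulr_sumr big_split/= sumr_const card_ord mulr_natl.
apply: ler_sum => i _; apply: ler_sum => j _.
apply: le_trans (ler_norm _) _; rewrite normrM -mulrA.
apply: ler_pM => //; rewrite ler_norml; apply/andP.
have := sqr_ge0 (v i - v j); have := sqr_ge0 (v i + v j).
by rewrite sqrrB sqrrD => ? ?; split; lra.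
Qed.

Section complex_forms.
Variable R : realType.
Local Notation C := (complex R).
Local Notation Re := complex.Re.
Local Notation Im := complex.Im.

Definition sqnorm (z : C) : R := Re z ^+ 2 + Im z ^+ 2.

Lemma mul_conj_sqnorm (z : C) : z * z^* = (real_complex R) (sqnorm z).
Proof. by case: z => x y; simpc; rewrite /sqnorm/=; congr (Complex _ _); ring. Qed.

Lemma sqnorm_ge0 (z : C) : 0 <= sqnorm z.
Proof. by rewrite addr_ge0// sqr_ge0. Qed.

Lemma sqnorm_eq0 (z : C) : (sqnorm z == 0) = (z == 0).
Proof. by case: z => x y; rewrite paddr_eq0 ?sqr_ge0// !sqrf_eq0 eq_complex. Qed.

Lemma Re_sum (I : finType) (F : I -> C) : Re (\sum_i F i) = \sum_i Re (F i).
Proof. exact: raddf_sum. Qed.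

Lemma Im_sum (I : finType) (F : I -> C) : Im (\sum_i F i) = \sum_i Im (F i).
Proof. exact: raddf_sum. Qed.

(** For real [A] the mixed products of real and imaginary parts only enter the imaginary part. This
    carries bounds on real forms over to complex eigenvectors. *)
Lemma Re_hermitian_form (n : nat) (A : 'M[R]_n) (w : 'rV[C]_n) :
  Re ((w *m map_mx (real_complex R) A *m map_mx Num.conj w^T) 0 0) =
  qform A (fun i => Re (w 0 i)) + qform A (fun i => Im (w 0 i)).
Proof.
rewrite mxE Re_sum /qform -big_split/=.
under [RHS]eq_bigr => i _ do rewrite -big_split/=.
rewrite [RHS]exchange_big/=; apply: eq_bigr => j _.
rewrite !mxE mulr_suml Re_sum; apply: eq_bigr => i _.
by rewrite !mxE; case: (w 0 i) (w 0 j) => [x y] [x' y']/=; ring.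
Qed.

(** The complexified matrix is Hermitian, hence unitarily diagonalizable with real spectrum. Its
    diagonal matches [eigenvalues] as a multiset because both split the characteristic
    polynomial. *)
Lemma spectral_decomposition (n : nat) (A : 'M[R]_n) : A^T = A ->
  exists (P : 'M[C]_n) (D : 'rV[R]_n),
    [/\ P *m map_mx Num.conj P^T = 1%:M,
        map_mx (real_complex R) A =
          map_mx Num.conj P^T *m diag_mx (map_mx (real_complex R) D) *m P &
        perm_eq (eigenvalues A) [seq D 0 i | i <- enum 'I_n]].
Proof.
move=> symA; pose B : 'M[C]_n := map_mx (real_complex R) A.
have realB : B \is a mxOver Num.real.
  by apply/mxOverP => i j; rewrite mxE; apply/complex_realP; exists (A i j).
have hermB : B \is hermsymmx.
  apply: realsym_hermsym => //; apply/is_hermitianmxP.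
  by rewrite expr0 scale1r map_mx_id// /B matrix.map_trmx symA.
have /orthomx_spectralP BE := hermitian_normalmx hermB.
have /mxOverP realsp := hermitian_spectral_diag_real hermB.
pose D : 'rV[R]_n := \row_i Re (spectral_diag B 0 i).
have DE : map_mx (real_complex R) D = spectral_diag B.
  by apply/rowP => i; rewrite !mxE RRe_real.
have uP := spectral_unitarymx B.
exists (spectralmx B), D; split.
- exact/unitarymxP.
- by rewrite DE -invmx_unitary.
have [_ _ EE] := eigenvaluesP symA.
apply/prod_XsubC_eq; rewrite -EE big_map big_enum/=.
apply: (@map_poly_inj _ _ (real_complex R)).
rewrite map_char_poly -/B [in LHS]BE char_poly_conj ?spectral_unit//.
rewrite char_poly_trig ?diag_mx_is_trig// rmorph_prod/=.
apply: eq_bigr => i _; rewrite rmorphB/= map_polyX map_polyC/= -DE.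
by rewrite !mxE eqxx mulr1n.
Qed.

(** The rows of [P] form an orthonormal basis in which the form is diagonal, and [c] holds the
    coordinates of [c *m P] in it. *)
Lemma hermitian_form_spectral (n : nat) (A : 'M[R]_n) (P : 'M[C]_n)
    (D : 'rV[R]_n) (c : 'rV[C]_n) :
  P *m map_mx Num.conj P^T = 1%:M ->
  map_mx (real_complex R) A =
    map_mx Num.conj P^T *m diag_mx (map_mx (real_complex R) D) *m P ->
  qform A (fun i => Re ((c *m P) 0 i)) + qform A (fun i => Im ((c *m P) 0 i)) =
  \sum_i sqnorm (c 0 i) * D 0 i.
Proof.
move=> uP AE; rewrite -Re_hermitian_form AE trmx_mul map_mxM !mulmxA.
rewrite -(mulmxA c) uP mulmx1. rewrite -(mulmxA _ P).
rewrite [X in _ *m X *m _]uP mulmx1.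
rewrite mxE Re_sum; apply: eq_bigr => i _.
rewrite mul_mx_diag !mxE mulrAC mul_conj_sqnorm/=; ring.
Qed.

Lemma sqnorm_unitary (n : nat) (P : 'M[C]_n) (c : 'rV[C]_n) :
  P *m map_mx Num.conj P^T = 1%:M ->
  \sum_i sqnorm ((c *m P) 0 i) = \sum_i sqnorm (c 0 i).
Proof.
move=> uP.
have sE (w : 'rV[C]_n) :
    \sum_i sqnorm (w 0 i) = Re ((w *m map_mx Num.conj w^T) 0 0).
  rewrite mxE Re_sum; apply: eq_bigr => i _.
  by rewrite !mxE mul_conj_sqnorm.
by rewrite !sE trmx_mul map_mxM mulmxA -(mulmxA c) uP mulmx1.
Qed.

End complex_forms.

(* Weyl's argument: the eigenvectors with eigenvalue above [n delta] number at
   most [#|I|], since otherwise some combination of them would be annihilated by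
   the low-rank part of [A]. *)
Lemma card_large_eigenvalues (R : realType) (n : nat) (A : 'M[R]_n)
    (I : finType) (a : 'I_n -> I -> R) (b : I -> 'I_n -> R) (delta : R)
    (P : 'M[complex R]_n) (D : 'rV[R]_n) :
  (forall i j, `|A i j - \sum_m a i m * b m j| <= delta) ->
  P *m map_mx Num.conj P^T = 1%:M ->
  map_mx (real_complex R) A =
    map_mx Num.conj P^T *m diag_mx (map_mx (real_complex R) D) *m P ->
  (#|[pred i | n%:R * delta < D 0 i]%R| <= #|I|)%N.
Proof.
move=> Ale uP AE; set S := [pred i | _]; rewrite leqNgt; apply/negP => IS.
pose X : 'M[complex R]_(n, #|I|) := \matrix_(i, m) real_complex R (a i (enum_val m)).
pose sel : 'M[complex R]_(#|S|, n) := rowsub enum_val 1%:M.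
(* There are [#|S|] rows and only [#|I|] columns, so the left kernel contains a nonzero [c0], the
   coefficients of a combination of the eigenvectors in [S]. *)
have /rowV0Pn[c0 /sub_kermxP c0Y c0_neq0] : kermx (sel *m P *m X) != 0.
  rewrite -mxrank_eq0 mxrank_ker subn_eq0 -ltnNge.
  exact: leq_ltn_trans (rank_leq_col _) IS.
pose c := c0 *m sel.
have cE s : c 0 (enum_val s) = c0 0 s.
  rewrite mxE (bigD1 s)//= big1 ?addr0; first by rewrite !mxE eqxx mulr1.
  by move=> t ts; rewrite !mxE (inj_eq enum_val_inj) (negbTE ts) mulr0.
have c_out i : i \notin S -> c 0 i = 0.
  move=> iS; rewrite mxE big1// => s _; rewrite !mxE.
  have [si|] := eqVneq (enum_val s) i; last by rewrite mulr0.
  by rewrite -si enum_valP in iS.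
have [s cs_neq0] : exists s, c0 0 s != 0 by apply/rV0Pn.
have ann m : \sum_i (c *m P) 0 i * real_complex R (a i m) = 0.
  have : (c *m P *m X) 0 (enum_rank m) = 0 
    by rewrite /c -!mulmxA (mulmxA sel) c0Y mxE.
  by rewrite mxE; under eq_bigr do rewrite [X _ _]mxE enum_rankK.
have annRe m : \sum_i complex.Re ((c *m P) 0 i) * a i m = 0.
  transitivity (complex.Re (\sum_i (c *m P) 0 i * real_complex R (a i m))).
    by rewrite Re_sum; apply: eq_bigr => i _; case: ((c *m P) 0 i) => x y/=; ring.
  by rewrite ann.
have annIm m : \sum_i complex.Im ((c *m P) 0 i) * a i m = 0.
  transitivity (complex.Im (\sum_i (c *m P) 0 i * real_complex R (a i m))).
    by rewrite Im_sum; apply: eq_bigr => i _; case: ((c *m P) 0 i) => x y/=; ring.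
  by rewrite ann.
(* Annihilation bounds the form by [n%:R * delta] times the squared norm. The spectral expansion of
   [c], supported on [S], makes it strictly larger, a nonzero coefficient giving strictness. *)
have := lerD (qform_low_rank_le Ale annRe) (qform_low_rank_le Ale annIm).
rewrite (hermitian_form_spectral _ uP AE) -mulrDr -big_split/=.
rewrite (sqnorm_unitary c uP) mulr_sumr leNgt => /negP; apply.
have i0S : n%:R * delta < D 0 (enum_val s) by have := enum_valP s; rewrite inE.
rewrite (bigD1 (enum_val s))//= [ltRHS](bigD1 (enum_val s))//=.
apply: ltr_leD.
  rewrite mulrC ltr_pM2l// lt_def sqnorm_ge0 sqnorm_eq0 cE.
  by rewrite cs_neq0.
apply: ler_sum => i _; rewrite mulrC.
have [iS|/c_out ->] := boolP (i \in S).
  by rewrite ler_wpM2l ?sqnorm_ge0// ltW//; move: iS; rewrite inE.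
by rewrite /sqnorm/= expr0n/= addr0 !mul0r.
Qed.

(** An eigenvalue above [n%:R * delta] contributes at most 1, and at most [#|I|] of them exist; each
    other one contributes at most [n%:R * delta / (tau * n%:R) = delta / tau]. *)
Lemma effective_dim_low_rank (R : realType) (n : nat) (A : 'M[R]_n)
    (I : finType) (a : 'I_n -> I -> R) (b : I -> 'I_n -> R) (delta tau : R) :
  A^T = A -> (forall v, 0 <= qform A v) -> 0 < tau -> (0 < n)%N -> 0 <= delta ->
  (forall i j, `|A i j - \sum_m a i m * b m j| <= delta) ->
  effective_dim A tau <= #|I|%:R + n%:R * delta / tau.
Proof.
move=> symA psdA tau_gt0 n_gt0 delta_ge0 Ale.
have [P [D [uP AE eigE]]] := spectral_decomposition symA.
have D_ge0 i : 0 <= D 0 i.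
  have := hermitian_form_spectral (delta_mx 0 i) uP AE.
  rewrite (bigD1 i)//= big1 ?addr0 => [|j ji].
    by rewrite mxE !eqxx/= /sqnorm/= expr1n expr0n/= addr0 mul1r => <-; exact: addr_ge0.
  by rewrite mxE (negbTE ji) andbF /sqnorm/= expr0n/= addr0 mul0r.
have mu_gt0 : 0 < tau * n%:R by rewrite mulr_gt0// ltr0n.
have [sizeE _ _] := eigenvaluesP symA.
have -> : effective_dim A tau = \sum_i D 0 i / (D 0 i + tau * n%:R).
  transitivity (\sum_(x <- eigenvalues A) x / (x + tau * n%:R)).
    by rewrite (big_nth 0) sizeE big_mkord.
  by rewrite (perm_big _ eigE)/= big_map big_enum.
pose S := [pred i | n%:R * delta < D 0 i].
rewrite (bigID [in S])/=; apply: lerD.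
  apply: (@le_trans _ _ (\sum_(i in S) 1)).
    by apply: ler_sum => i _; rewrite ler_pdivrMr ?mul1r ?lerDl ?ltW// ltr_wpDl.
  by rewrite sumr_const ler_nat; exact: card_large_eigenvalues Ale uP AE.
apply: (@le_trans _ _ (\sum_(i < n) delta / tau)); last first.
  by rewrite sumr_const card_ord -[leLHS]mulr_natl mulrA.
rewrite [leRHS](bigID [in S])/=; apply: ler_wpDl.
  by apply: sumr_ge0 => i _; rewrite divr_ge0// ltW.
apply: ler_sum => i; rewrite inE -leNgt => Dle.
rewrite ler_pdivrMr ?ltr_wpDl//.
rewrite (le_trans Dle)// mulrDr [delta / tau * (tau * _)]mulrA divfK ?gt_eqF//.
by rewrite mulrC lerDr mulr_ge0// divr_ge0// ltW.
Qed.

(** * Taylor's formula in one variable and the exponential series *)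

(** The mean value theorem is applied to [H N], the Taylor polynomial with moving base point [s]
    evaluated at 1, whose derivative telescopes. This is Cauchy's remainder, hence the factorial of
    [N] and not of [N.+1]. *)
Lemma taylor_unit_interval (R : realType) (N : nat) (g : nat -> R -> R) (B : R) :
  (forall m (s : R), 0 <= s <= 1 -> is_derive s 1 (g m) (g m.+1 s)) ->
  (forall s : R, 0 <= s <= 1 -> `|g N.+1 s| <= B) ->
  `|g 0 1 - \sum_(m < N.+1) g m 0 / m`!%:R| <= B / N`!%:R.
Proof.
move=> dg gB.
pose H n (s : R) := \sum_(m < n.+1) g m s * ((1 - s) ^+ m / m`!%:R).
have dH n (s : R) : 0 <= s <= 1 ->
    is_derive s 1 (H n) (g n.+1 s * ((1 - s) ^+ n / n`!%:R)).
  move=> s01; elim: n => [|n IHn].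
    have -> : H 0 = g 0.
      by apply/funext => t; rewrite /H big_ord1 expr0 divr1 mulr1.
    by rewrite expr0 divr1 mulr1; exact: dg.
  have -> : H n.+1 = H n + g n.+1 * (n.+1`!%:R^-1 \*: (cst 1 - id) ^+ n.+1).
    apply/funext => t; rewrite /H big_ord_recr/= !fctE; congr (_ + _ * _).
    exact: mulrC.
  have dgn := dg n.+1 _ s01.
  apply: is_derive_eq; rewrite /= !fctE /GRing.scale/= factS natrM.
  have n1 : n.+1%:R != 0 :> R by rewrite pnatr_eq0.
  have nf : n`!%:R != 0 :> R by rewrite pnatr_eq0 -lt0n fact_gt0.
  move: n1 nf; rewrite exprS; move: (n.+1%:R) (n`!%:R) => p q p0 q0.
  by field; rewrite ?p0 ?q0.
have [] := @MVT R (H N) (fun s => g N.+1 s * ((1 - s) ^+ N / N`!%:R)) 0 1.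
- exact: ltr01.
- by move=> s; rewrite in_itv/= => /andP[/ltW ? /ltW ?]; apply: dH; apply/andP.
- apply: derivable_within_continuous => s; rewrite in_itv/= => /(dH N)[].
  by [].
move=> c; rewrite in_itv/= => /andP[c0 c1]; rewrite subr0 mulr1.
have -> : H N 1 = g 0 1.
  rewrite /H big_ord_recl big1 ?addr0 => [|m _]; first by rewrite expr0 divr1 mulr1.
  by rewrite subrr expr0n mul0r mulr0.
have -> : H N 0 = \sum_(m < N.+1) g m 0 / m`!%:R.
  by apply: eq_bigr => m _; rewrite subr0 expr1n mul1r.
have c1' : 0 <= 1 - c <= 1 by rewrite subr_ge0 gerBl !ltW.
have /andP[? ?] := c1'.
move=> ->; rewrite normrM ler_pM//; first by apply: gB; rewrite !ltW.
rewrite ger0_norm; last by rewrite divr_ge0 ?exprn_ge0.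
by rewrite ler_piMl ?invr_ge0// exprn_ile1.
Qed.

(** Taylor's formula for [t |-> expR (- s * t)] on the unit interval, where the exponential is at
    most 1. *)
Lemma expR_taylor_le (R : realType) (N : nat) (s B : R) : 0 <= s <= B ->
  `|expR (- s) - \sum_(m < N.+1) (- s) ^+ m / m`!%:R| <= B ^+ N.+1 / N`!%:R.
Proof.
move=> /andP[s0 sB].
pose g m (t : R) := (- s) ^+ m * expR (- s * t).
have g01 : g 0 1 = expR (- s) by rewrite /g expr0 mul1r mulr1.
have g0 m : g m 0 = (- s) ^+ m by rewrite /g mulr0 expR0 mulr1.
rewrite -g01; under eq_bigr do rewrite -g0.
apply: taylor_unit_interval.
- move=> m t _; rewrite /g.
  have -> : (fun t => (- s) ^+ m * expR (- s * t)) =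
      (- s) ^+ m \*: (expR \o (- s \*: id)) by [].
  by apply: is_derive_eq; rewrite /GRing.scale/= mulr1 exprS; ring.
move=> t /andP[t0 _]; rewrite /g normrM normrX normrN (ger0_norm s0).
rewrite -[leRHS]mulr1; apply: ler_pM => //.
  by rewrite exprn_ge0.
  by rewrite lerXn2r// nnegrE ?(le_trans s0).
by rewrite ger0_norm ?expR_ge0// expR_le1 mulNr oppr_le0 mulr_ge0.
Qed.

(** [(2 * A) ^+ N] over the factorial of [N] is a term of the series of [expR (2 * A)]. The added 1
    keeps the constant positive when [A = 0]. *)
Lemma expr_fact_le_geometric (R : realType) (A : R) : 0 <= A ->
  exists C : R, 0 < C /\ forall N, A ^+ N.+1 / N`!%:R <= C * 2 ^- N.
Proof.
move=> A0; exists (A * expR (2 * A) + 1); split.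
  by rewrite ltr_wpDl// mulr_ge0// expR_ge0.
move=> N; rewrite mulrDl mul1r ler_wpDr ?invr_ge0 ?exprn_ge0//.
rewrite exprS -!mulrA ler_wpM2l// ler_pdivlMr ?exprn_gt0// mulrAC -exprMn.
rewrite (mulrC A); case: N => [|N].
  by rewrite expr0 divr1 -expR0 ler_expR mulr_ge0.
have A20 : 0 <= 2 * A by rewrite mulr_ge0.
by have := expR_ge1Dxn N A20; apply: le_trans; rewrite lerDr.
Qed.


(** * The Euclidean norm and positivity of the Gaussian kernel *)

Lemma sqr_l2norm (R : realType) (m : nat) (u : 'rV[R]_m) :
  l2norm u ^+ 2 = \sum_i u 0 i ^+ 2.
Proof. by rewrite sqr_sqrtr// sumr_ge0// => i _; exact: sqr_ge0. Qed.

(** Up to the diagonal rescaling [w], the kernel is [expR (2 * eta * ip i j)], a power series with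
    nonnegative coefficients in the Gram matrix [ip]. Entrywise powers of [ip] are Gram matrices of
    tensor powers, so their forms are sums of squares. *)
Lemma gaussian_kernel_psd (R : realType) (d n : nat) (eta : R)
    (x : 'I_n -> 'rV[R]_d) (v : 'I_n -> R) : 0 <= eta ->
  0 <= qform (gaussian_kernel eta x) v.
Proof.
move=> eta0.
pose ip (i j : 'I_n) : R := \sum_(l < d) x i 0 l * x j 0 l.
pose w i := v i * expR (- eta * l2norm (x i) ^+ 2).
have KE i j : gaussian_kernel eta x i j * (v i * v j) =
    w i * w j * expR (2 * eta * ip i j).
  rewrite mxE /w; set a := l2norm (x i); set b := l2norm (x j).
  transitivity (expR (- eta * a ^+ 2 + - eta * b ^+ 2 + 2 * eta * ip i j) * (v i * v j)).
    congr (expR _ * _).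
    rewrite !sqr_l2norm /ip !mulr_sumr -!big_split/=; apply: eq_bigr => l _.
    by rewrite !mxE; ring.
  by rewrite !expRD; ring.
have ipX m : 0 <= \sum_i \sum_j w i * w j * ip i j ^+ m.
  have -> : \sum_i \sum_j w i * w j * ip i j ^+ m =
      \sum_(f : {ffun 'I_m -> 'I_d}) (\sum_i w i * \prod_l x i 0 (f l)) ^+ 2.
    transitivity (\sum_i \sum_j \sum_(f : {ffun 'I_m -> 'I_d})
        (w i * \prod_l x i 0 (f l)) * (w j * \prod_l x j 0 (f l))).
      apply: eq_bigr => i _; apply: eq_bigr => j _.
      have -> : ip i j ^+ m = \prod_(l < m) ip i j by rewrite prodr_const card_ord.
      rewrite /ip bigA_distr_bigA/= mulr_sumr; apply: eq_bigr => f _.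
      by rewrite big_split/=; ring.
    under eq_bigr do rewrite exchange_big; rewrite exchange_big/=.
    apply: eq_bigr => f _; rewrite expr2 mulr_suml; apply: eq_bigr => i _.
    by rewrite mulr_sumr.
  by apply: sumr_ge0 => f _; exact: sqr_ge0.
rewrite /qform; under eq_bigr do under eq_bigr do rewrite KE.
pose S N := \sum_i \sum_j w i * w j * series (exp_coeff (2 * eta * ip i j)) N.
have S_ge0 N : 0 <= S N.
  have -> : S N = \sum_(0 <= m < N) (2 * eta) ^+ m / m`!%:R *
      \sum_i \sum_j w i * w j * ip i j ^+ m.
    rewrite /S /series/=; under eq_bigr do under eq_bigr do rewrite mulr_sumr.
    under eq_bigr do rewrite exchange_big/=.
    rewrite exchange_big/=; apply: eq_bigr => m _; rewrite mulr_sumr.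
    apply: eq_bigr => i _; rewrite mulr_sumr; apply: eq_bigr => j _.
    by rewrite /exp_coeff/= exprMn; ring.
  apply: sumr_ge0 => m _; rewrite mulr_ge0// divr_ge0// exprn_ge0//.
  by rewrite mulr_ge0.
suff cS : S N @[N --> \oo] --> \sum_i \sum_j w i * w j * expR (2 * eta * ip i j).
  by apply: (cvgr_to_ge cS); exact: nearW.
apply: cvg_big => [|i _]; first exact: add_continuous.
apply: cvg_big => [|j _]; first exact: add_continuous.
by apply: cvgMr; exact: is_cvg_series_exp_coeff.
Qed.

Lemma l2norm_mono (R : realType) (m : nat) (u w : 'rV[R]_m) :
  (forall i, `|u 0 i| <= `|w 0 i|) -> l2norm u <= l2norm w.
Proof.
move=> uw; rewrite ler_wsqrtr// ler_sum// => i _.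
by rewrite -(real_normK (num_real (u 0 i))) -(real_normK (num_real (w 0 i))) lerXn2r.
Qed.

Lemma coord_le_l2norm (R : realType) (m : nat) (u : 'rV[R]_m) i :
  `|u 0 i| <= l2norm u.
Proof.
rewrite -(@ler_pXn2r _ 2)// ?nnegrE ?sqrtr_ge0// sqr_l2norm.
by rewrite (bigD1 i)//= real_normK ?num_real// lerDl sumr_ge0// => j _; exact: sqr_ge0.
Qed.

Lemma l2norm_continuous (R : realType) (m : nat) :
  continuous (@l2norm R m).
Proof.
have sc : continuous (fun u : 'rV[R]_m => \sum_i u 0 i ^+ 2).
  apply: continuous_big => [|i _]; first exact: add_continuous.
  by move=> x; apply: (@cvgM _ _ (nbhs x)); exact: coord_continuous.
by move=> x; apply: continuous_comp; [exact: sc|exact: sqrt_continuous].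
Qed.

Lemma open_l2ball (R : realType) (m : nat) (rho : R) :
  open (l2ball rho : set 'rV[R]_m).
Proof.
apply: (@open_comp _ _ (@l2norm R m) [set x | x < rho]); last exact: open_lt.
by move=> x _; exact: l2norm_continuous.
Qed.

(** * Derivatives of smooth maps and Taylor expansion in one coordinate *)

(** As [A] is open, a local smooth extension agrees with [f] on a whole neighbourhood, and so do all
    iterated partial derivatives. *)
Lemma smooth_on_open_derivable (R : realType) (m p : nat) (A : set 'rV[R]_m)
    (f : 'rV[R]_m -> 'rV[R]_p) (s : seq 'I_m) (x : 'rV[R]_m) (i : 'I_m) :
  open A -> smooth_on A f -> A x ->
  derivable (pderivs s f) x (delta_mx 0 i).
Proof.
move=> oA sf Ax; have [V [F [oV Vx sF FE]]] := sf x Ax.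
have oAV : open (A `&` V) by exact: openI.
have nE t y : (A `&` V) y -> {near y, pderivs t F =1 pderivs t f}.
  elim: t y => [|j t IHt] y AVy; near=> z.
    by apply: FE; near: z; exact: open_nbhs_nbhs.
  have AVz : (A `&` V) z by near: z; exact: open_nbhs_nbhs.
  exact: near_eq_derive (IHt _ AVz).
apply: (near_eq_derivable (nE s x _)) => //.
exact: (sF s x Vx).2.
Unshelve. all: by end_near. Qed.

Lemma is_derive_line (R : realType) (m : nat) (f : 'rV[R]_m -> R)
    (y v : 'rV[R]_m) (t df : R) :
  is_derive (y + t *: v) v f df -> is_derive t 1 (fun s => f (y + s *: v)) df.
Proof.
have E : (fun h : R => h^-1 *: (f (h *: v + (y + t *: v)) - f (y + t *: v))) =
    (fun h : R => h^-1 *: (f (y + (h *: 1 + t) *: v) - f (y + t *: v))).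
  apply/funext => h; congr (_ *: (f _ - _)).
  by rewrite scalerDl /GRing.scale/= mulr1 addrCA.
case; rewrite /derivable /derive /= E => cf fE.
by apply: DeriveDef; rewrite /derivable /derive.
Qed.

(** One-variable Taylor expansion along the segment from [u0], which is [u] with coordinate [i] set
    to 0, to [u]. Shrinking a coordinate does not increase the norm, so the segment stays in the
    ball. *)
Lemma taylor_coord (R : realType) (m p N : nat) (f : 'rV[R]_m -> 'rV[R]_p)
    (rho B : R) (i : 'I_m) (l : 'I_p) (u u0 : 'rV[R]_m) :
  (forall a y, l2ball rho y ->
     derivable (pderivs (nseq a i) f) y (delta_mx 0 i)) ->
  (forall y, l2ball rho y -> `|pderivs (nseq N.+1 i) f y 0 l| <= B) ->
  l2ball rho u -> u0 = u - u 0 i *: delta_mx 0 i ->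
  `|f u 0 l - \sum_(a < N.+1) u 0 i ^+ a / a`!%:R * pderivs (nseq a i) f u0 0 l|
    <= `|u 0 i| ^+ N.+1 * B / N`!%:R.
Proof.
move=> df fB ub u0E.
pose g a (s : R) :=
  u 0 i ^+ a * pderivs (nseq a i) f (u0 + (u 0 i * s) *: delta_mx 0 i) 0 l.
have gb s : 0 <= s <= 1 -> l2ball rho (u0 + (u 0 i * s) *: delta_mx 0 i).
  move=> /andP[s0 s1]; apply: le_lt_trans ub; apply: l2norm_mono => j.
  rewrite u0E !mxE eqxx/=; have [->|_] := eqVneq j i.
    by rewrite !mulr1 subrr add0r normrM ler_piMr// ger0_norm.
  by rewrite !mulr0 subr0 addr0.
have g1 : g 0 1 = f u 0 l.
  by rewrite /g expr0 mul1r mulr1 u0E subrK.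
have g0 a : g a 0 / a`!%:R = u 0 i ^+ a / a`!%:R * pderivs (nseq a i) f u0 0 l.
  by rewrite /g mulr0 scale0r addr0 mulrAC.
rewrite -g1; under eq_bigr do rewrite -g0.
apply: taylor_unit_interval.
- move=> a s /gb sb; rewrite /g.
  set G := fun y => pderivs (nseq a i) f y 0 l.
  have dG : is_derive (u0 + (u 0 i * s) *: delta_mx 0 i) (delta_mx 0 i) G
      (pderivs (nseq a.+1 i) f (u0 + (u 0 i * s) *: delta_mx 0 i) 0 l).
    have D := df a _ sb; apply: DeriveDef.
      exact: (derivable_mxP _ _ _).1 D 0 l.
    by rewrite [in RHS]/= /pderiv derive_mx// mxE.
  have {}dG := is_derive_line dG.
  have -> : (fun t => u 0 i ^+ a *
       pderivs (nseq a i) f (u0 + (u 0 i * t) *: delta_mx 0 i) 0 l) =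
     u 0 i ^+ a \*: ((fun t => G (u0 + t *: delta_mx 0 i)) \o (u 0 i \*: id)) by [].
  apply: is_derive_eq; rewrite /GRing.scale/= mulr1 exprS; ring.
move=> s /gb sb; rewrite /g normrM normrX ler_pM//; exact: fB.
Qed.

(** * Polynomial functions of bounded degree in each variable *)

(* Degree at most D in each variable separately, not total degree. *)
Definition poly_degree_le {R : realType} {m : nat} (D : nat)
    (f : 'rV[R]_m -> R) : Prop :=
  exists c : {ffun 'I_m -> 'I_D.+1} -> R,
    forall u, f u = \sum_alpha c alpha * \prod_i u 0 i ^+ alpha i.

Section poly_degree_le.
Context {R : realType} {m : nat}.
Implicit Types (f g : 'rV[R]_m -> R) (D : nat).

Lemma poly_degree_le_monomial D (a : 'I_m -> nat) : (forall i, a i <= D)%N ->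
  poly_degree_le D (fun u : 'rV[R]_m => \prod_i u 0 i ^+ a i).
Proof.
move=> aD; exists (fun alpha => (alpha == [ffun i => inord (a i)])%:R) => u.
rewrite [RHS](bigD1 [ffun i => inord (a i)])//= eqxx mul1r [X in _ = _ + X]big1 ?addr0.
  by apply: eq_bigr => i _; rewrite ffunE inordK ?ltnS.
by move=> alpha /negPf ->; rewrite mul0r.
Qed.

Lemma poly_degree_le_sum D (I : finType) (F : I -> 'rV[R]_m -> R) :
  (forall i, poly_degree_le D (F i)) ->
  poly_degree_le D (fun u => \sum_i F i u).
Proof.
move=> /choice[c cE]; exists (fun alpha => \sum_i c i alpha) => u.
under eq_bigr do rewrite cE; rewrite exchange_big/=.
by apply: eq_bigr => alpha _; rewrite mulr_suml.
Qed.

Lemma poly_degree_leZ D (x : R) f :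
  poly_degree_le D f -> poly_degree_le D (fun u => x * f u).
Proof.
move=> [c cE]; exists (fun alpha => x * c alpha) => u.
by rewrite cE mulr_sumr; apply: eq_bigr => alpha _; rewrite mulrA.
Qed.

Lemma poly_degree_leM D D' f g :
  poly_degree_le D f -> poly_degree_le D' g ->
  poly_degree_le (D + D') (fun u => f u * g u).
Proof.
move=> [c cE] [c' cE'].
have -> : (fun u => f u * g u) = (fun u => \sum_alpha c alpha * \sum_beta
    c' beta * \prod_i u 0 i ^+ (alpha i + beta i)).
  apply/funext => u; rewrite cE cE' mulr_suml; apply: eq_bigr => alpha _.
  rewrite -mulrA; congr (_ * _); rewrite mulr_sumr; apply: eq_bigr => beta _.
  under [in RHS]eq_bigr do rewrite exprD; rewrite big_split/=; ring.
apply: poly_degree_le_sum => alpha; apply: poly_degree_leZ.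
apply: poly_degree_le_sum => beta; apply: poly_degree_leZ.
apply: poly_degree_le_monomial => i.
by apply: leq_add; rewrite -ltnS.
Qed.

Lemma poly_degree_leW D D' f : (D <= D')%N ->
  poly_degree_le D f -> poly_degree_le D' f.
Proof.
move=> DD' [c cE].
have -> : f = (fun u => \sum_alpha c alpha * \prod_i u 0 i ^+ alpha i).
  exact/funext.
apply: poly_degree_le_sum => alpha; apply: poly_degree_leZ.
apply: poly_degree_le_monomial => i; apply: leq_trans DD'.
by rewrite -ltnS.
Qed.

Lemma poly_degree_le_cst D (x : R) : poly_degree_le D (fun _ : 'rV[R]_m => x).
Proof.
have -> : (fun _ : 'rV[R]_m => x) = fun u => x * \prod_i u 0 i ^+ 0.
  by apply/funext => u; rewrite big1 ?mulr1// => i _; rewrite expr0.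
exact/poly_degree_leZ/poly_degree_le_monomial.
Qed.

Lemma poly_degree_leD D f g :
  poly_degree_le D f -> poly_degree_le D g ->
  poly_degree_le D (fun u => f u + g u).
Proof.
move=> [c cE] [c' cE']; exists (fun alpha => c alpha + c' alpha) => u.
by rewrite cE cE' -big_split/=; apply: eq_bigr => alpha _; rewrite mulrDl.
Qed.

Lemma poly_degree_leX D n f :
  poly_degree_le D f -> poly_degree_le (n * D) (fun u => f u ^+ n).
Proof.
move=> fD; elim: n => [|n IHn]; first exact: poly_degree_le_cst.
under eq_fun do rewrite exprS.
by rewrite mulSn; exact: poly_degree_leM.
Qed.

Lemma poly_degree_le_coordX D (i : 'I_m) n : (n <= D)%N ->
  poly_degree_le D (fun u : 'rV[R]_m => u 0 i ^+ n).
Proof.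
move=> nD.
have -> : (fun u : 'rV[R]_m => u 0 i ^+ n) =
    fun u => \prod_j u 0 j ^+ (if j == i then n else 0).
  apply/funext => u; rewrite (bigD1 i)//= eqxx big1 ?mulr1// => j /negbTE ->.
  by rewrite expr0.
by apply: poly_degree_le_monomial => j; case: ifP.
Qed.

End poly_degree_le.

(** * Polynomial approximation of the charts *)

Lemma sum_exp_coeff_le (R : realType) (N : nat) (x : R) : 0 <= x ->
  \sum_(a < N) x ^+ a / a`!%:R <= expR x.
Proof.
move=> x0; have -> : \sum_(a < N) x ^+ a / a`!%:R = series (exp_coeff x) N.
  by rewrite /series/= big_mkord.
apply: nondecreasing_cvgn_le; last exact: is_cvg_series_exp_coeff.
by apply: nondecreasing_series => n _ _; exact: exp_coeff_ge0.
Qed.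

(** These are the successive base points when coordinates are expanded one at a time; the last one
    is the origin. *)
Definition mask_coords {R : realType} {m : nat} (s : seq 'I_m) (u : 'rV[R]_m) :
  'rV[R]_m := \row_i (if i \in s then u 0 i else 0).

(** For [s] the enumeration of all coordinates this is the order of differentiation in [mderiv]. *)
Definition block_seq {m : nat} (a : 'I_m -> nat) (s : seq 'I_m) : seq 'I_m :=
  flatten [seq nseq (a i) i | i <- s].

Lemma pderivs_cat (R : realType) (m p : nat) (s t : seq 'I_m)
    (f : 'rV[R]_m -> 'rV[R]_p) :
  pderivs (s ++ t) f = pderivs s (pderivs t f).
Proof. exact: foldr_cat. Qed.

(* The coordinates are expanded from the last to the first, so that only
   derivatives in the canonical order occur and no symmetry of mixed partial
   derivatives is needed. *)
Lemma taylor_mask (R : realType) (m p : nat) (rho Q : R) (l : 'I_p)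
    (s : seq 'I_m) : 0 <= Q -> 0 <= rho -> uniq s ->
  exists C : R, 0 <= C /\
    forall (f : 'rV[R]_m -> 'rV[R]_p) (A : R) (N : nat), 0 <= A ->
    (forall t y i, l2ball rho y -> derivable (pderivs t f) y (delta_mx 0 i)) ->
    (forall (a : 'I_m -> nat) y, (0 < \sum_(i <- s) a i)%N -> l2ball rho y ->
      `|pderivs (block_seq a s) f y 0 l| <= A * Q ^+ (\sum_(i <- s) a i)) ->
    exists2 P, poly_degree_le (size s * N) P &
      forall u, l2ball rho u ->
        `|f (mask_coords s u) 0 l - P u| <= A * C * ((Q * rho) ^+ N.+1 / N`!%:R).
Proof.
move=> Q0 rho0; elim/last_ind: s => [_|s i IHs].
  exists 0; split=> // f A N A0 _ _; exists (fun=> f 0 0 l).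
    exact: poly_degree_le_cst.
  move=> u _; rewrite (_ : mask_coords _ _ = 0) ?subrr ?normr0 ?mulr0 ?mul0r//.
  by apply/rowP => j; rewrite !mxE.
rewrite rcons_uniq => /andP[iNs /IHs[C [C0 HC]]].
(* The 1 pays for the expansion in coordinate [i]. The errors [C] of the approximated coefficients
   are weighted by terms of the series of [expR (Q * rho)]. *)
exists (1 + C * expR (Q * rho)); split; first by rewrite addr_ge0// mulr_ge0// expR_ge0.
move=> f A N A0 df fB.
pose ext (a : 'I_m -> nat) n j := if j == i then n else a j.
have extE a n : (\sum_(j <- rcons s i) ext a n j = \sum_(j <- s) a j + n)%N.
  rewrite -cats1 big_cat big_seq1 /ext eqxx; congr (_ + _)%N.
  by apply: eq_big_seq => j js; case: eqP => // ji; rewrite -ji js in iNs.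
have block_ext a n :
    pderivs (block_seq (ext a n) (rcons s i)) f =
    pderivs (block_seq a s) (pderivs (nseq n i) f).
  rewrite -pderivs_cat /block_seq -cats1 map_cat flatten_cat/= cats0 /ext eqxx.
  congr (pderivs (flatten _ ++ _) _); apply/eq_in_map => j js.
  by case: eqP => // ji; rewrite -ji js in iNs.
pose f_ (a : 'I_N.+1) := pderivs (nseq a i) f.
have /choice[P HP] : forall a : 'I_N.+1, exists P, poly_degree_le (size s * N) P /\
    forall u, l2ball rho u -> `|f_ a (mask_coords s u) 0 l - P u| <=
      A * Q ^+ a * C * ((Q * rho) ^+ N.+1 / N`!%:R).
  (* Differentiating [a] times in direction [i] costs a factor [Q ^+ a], absorbed by the free
     prefactor [A] of the induction hypothesis. *)
  move=> a; have [||b y bs yb|P PN PE] := HC (f_ a) (A * Q ^+ a) N.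
  - by rewrite mulr_ge0// exprn_ge0.
  - by move=> t y j yb; rewrite /f_ -pderivs_cat; exact: df.
  - rewrite /f_ -block_ext; apply: le_trans (fB _ _ _ yb) _.
      by rewrite extE (leq_trans bs)// leq_addr.
    by rewrite extE -mulrA -exprD addnC.
  by exists P.
exists (fun u : 'rV[R]_m => \sum_(a < N.+1) u 0 i ^+ a * (a`!%:R^-1 * P a u)).
  apply: poly_degree_le_sum => a; rewrite size_rcons mulSn.
  apply: poly_degree_leM; first by apply: poly_degree_le_coordX; rewrite -ltnS.
  by apply: poly_degree_leZ; exact: (HP a).1.
move=> u ub; set w := mask_coords (rcons s i) u.
have wb : l2ball rho w.
  apply: le_lt_trans ub; apply: l2norm_mono => j; rewrite mxE.
  by case: ifP => // _; rewrite normr0.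
have wi : w 0 i = u 0 i by rewrite mxE mem_rcons mem_head.
have fN y : l2ball rho y -> `|pderivs (nseq N.+1 i) f y 0 l| <= A * Q ^+ N.+1.
  move=> yb; have := fB (ext (fun=> 0%N) N.+1) y; rewrite extE big1// add0n.
  rewrite block_ext (_ : block_seq _ s = [::]); last first.
    by rewrite /block_seq; elim: s {IHs iNs HC fB extE block_ext HP w wb wi}.
  exact.
have w0 : mask_coords s u = w - w 0 i *: delta_mx 0 i.
  apply/rowP => j; rewrite !mxE !mem_rcons !inE !eqxx/=.
  have [->|ji] := eqVneq j i; first by rewrite (negbTE iNs) mulr1 subrr.
  by rewrite mulr0 subr0.
have := taylor_coord (fun a y => @df (nseq a i) y i) fN wb w0.
rewrite wi => T1.
(* The error splits into the Taylor remainder in coordinate [i] and the replacement of each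
   coefficient by its polynomial [P a]. *)
rewrite -(subrKA (\sum_(a < N.+1) u 0 i ^+ a / a`!%:R *
  pderivs (nseq a i) f (mask_coords s u) 0 l)).
apply: le_trans (ler_normD _ _) _.
have ui : `|u 0 i| <= rho by apply: le_trans (coord_le_l2norm u i) _; exact: ltW.
set E := (Q * rho) ^+ N.+1 / N`!%:R.
have E0 : 0 <= E by rewrite divr_ge0// exprn_ge0// mulr_ge0.
rewrite mulrDr mulr1 mulrDl; apply: lerD.
  apply: le_trans T1 _; rewrite /E exprMn mulrA ler_wpM2r ?invr_ge0//.
  rewrite mulrC -mulrA; apply: ler_wpM2l => //.
  by apply: ler_wpM2l; rewrite ?exprn_ge0// lerXn2r// nnegrE.
rewrite -sumrB; apply: le_trans (ler_norm_sum _ _ _) _.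
apply: (@le_trans _ _ (\sum_(a < N.+1) (Q * rho) ^+ a / a`!%:R * (A * C * E))).
  apply: ler_sum => a _; rewrite [X in _ - X]mulrA -mulrBr normrM.
  apply: (@le_trans _ _ (rho ^+ a / a`!%:R * (A * Q ^+ a * C * E))); last first.
    by rewrite exprMn le_eqVlt; apply/orP; left; apply/eqP; ring.
  apply: ler_pM => //; last exact: (HP a).2.
  rewrite normrM normrX [X in _ * X]ger0_norm ?invr_ge0// ler_wpM2r ?invr_ge0//.
  by rewrite lerXn2r// nnegrE.
rewrite -mulr_suml [leRHS](_ : _ = expR (Q * rho) * (A * C * E)); last by ring.
apply: ler_wpM2r; first exact: mulr_ge0 (mulr_ge0 A0 C0) E0.
by apply: sum_exp_coeff_le; rewrite mulr_ge0.
Qed.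

(** The Taylor remainder, [(Q * r) ^+ N.+1] over the factorial of [N], decays at least
    geometrically; summing the constants over the coordinates makes them uniform. *)
Lemma chart_poly_approx (R : realType) (k d : nat) (r Q : R)
    (phi : 'rV[R]_k -> 'rV[R]_d) :
  0 <= r -> 0 <= Q -> smooth_on (l2ball r) phi ->
  (forall (alpha : {ffun 'I_k -> nat}) u, (0 < mdegree alpha)%N ->
    l2ball r u -> l2norm (mderiv alpha phi u) <= Q ^+ mdegree alpha) ->
  exists C : R, 0 <= C /\ forall N l, exists2 P, poly_degree_le (k * N) P &
    forall u, l2ball r u -> `|phi u 0 l - P u| <= C * 2 ^- N.
Proof.
move=> r0 Q0 sphi phiB.
have [C0 [C0_gt0 C0E]] := expr_fact_le_geometric (mulr_ge0 Q0 r0).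
have /choice[C CP] : forall l : 'I_d, exists C : R, 0 <= C /\
    forall N, exists2 P, poly_degree_le (k * N) P &
      forall u, l2ball r u -> `|phi u 0 l - P u| <= C * 2 ^- N.
  move=> l.
  have [C [C_ge0 CP]] := taylor_mask l Q0 r0 (enum_uniq 'I_k).
  exists (C * C0); split=> [|N]; first exact: mulr_ge0 (ltW _).
  have [//|t y i yb|a y a0 yb|P PN PE] := CP phi 1 N.
  - exact: smooth_on_open_derivable (@open_l2ball _ _ r) sphi yb.
  - have bE : pderivs (block_seq a (enum 'I_k)) phi = mderiv (finfun a) phi.
      congr (pderivs (flatten _) _); apply/eq_in_map => i _.
      by rewrite ffunE.
    have dE : (\sum_(i <- enum 'I_k) a i)%N = mdegree (finfun a).
      by rewrite big_enum; apply: eq_bigr => i _; rewrite ffunE.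
    rewrite bE mul1r dE; rewrite dE in a0.
    exact: le_trans (coord_le_l2norm _ _) (phiB _ _ a0 yb).
  exists P; first by rewrite size_enum_ord in PN.
  move=> u ub; have := PE u ub.
  have -> : mask_coords (enum 'I_k) u = u by apply/rowP => i; rewrite mxE mem_enum.
  by move=> /le_trans; apply; rewrite mul1r -mulrA ler_wpM2l.
exists (\sum_l C l); split=> [|N l]; first by apply: sumr_ge0 => l _; have [] := CP l.
have [_ /(_ N)[P PN PE]] := CP l; exists P => // u /PE /le_trans; apply.
rewrite ler_wpM2r ?invr_ge0 ?exprn_ge0// (bigD1 l)//= lerDl sumr_ge0// => j _.
by have [] := CP j.
Qed.

(** * Polynomial approximation of the Gaussian along a chart *)

Lemma expRN_lipschitz (R : realType) (s t : R) : 0 <= s -> 0 <= t ->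
  `|expR (- s) - expR (- t)| <= `|s - t|.
Proof.
wlog st : s t / s <= t.
  move=> H s0 t0; have [st|/ltW ts] := leP s t; first exact: H.
  by rewrite distrC [leRHS]distrC; exact: H.
move=> s0 t0; rewrite ger0_norm ?subr_ge0 ?ler_expR ?lerN2//.
rewrite distrC ger0_norm ?subr_ge0//.
have -> : - t = - s + - (t - s) by ring.
rewrite expRD -{1}[expR (- s)]mulr1 -mulrBr.
have e1 : expR (- s) <= 1 by rewrite expR_le1 oppr_le0.
have := expR_ge1Dx (- (t - s)).
have := expR_ge0 (- s).
have : expR (- (t - s)) <= 1 by rewrite expR_le1 oppr_le0 subr_ge0.
by nra.
Qed.

(** Two replacements: [phi] by its polynomial inside the exponent, controlled by the Lipschitz
    bound, then the exponential by its series to order [N]. The squared distance has degree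
    [2 * (k * N)], and powers up to [N] occur. *)
Lemma gaussian_chart_poly_approx (R : realType) (k d : nat) (r Q rho eta : R)
    (phi : 'rV[R]_k -> 'rV[R]_d) :
  0 <= r -> 0 <= Q -> 0 <= rho -> 0 <= eta -> smooth_on (l2ball r) phi ->
  (forall (alpha : {ffun 'I_k -> nat}) u, (0 < mdegree alpha)%N ->
    l2ball r u -> l2norm (mderiv alpha phi u) <= Q ^+ mdegree alpha) ->
  (forall u, l2ball r u -> l2norm (phi u) <= rho) ->
  exists C : R, 0 <= C /\ forall N y, l2norm y <= rho ->
    exists2 P, poly_degree_le (N * (2 * (k * N))) P &
      forall u, l2ball r u ->
        `|expR (- eta * l2norm (phi u - y) ^+ 2) - P u| <= C * 2 ^- N.
Proof.
move=> r0 Q0 rho0 eta0 sphi phiB phirho.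
have [C1 [C1_ge0 qE]] := chart_poly_approx r0 Q0 sphi phiB.
(* [B] bounds the polynomial exponent: each [q l u] is within [C1] of [phi u 0 l], which is within
   [2 * rho] of [y 0 l]. *)
pose B := eta * \sum_(l < d) (2 * rho + C1) ^+ 2.
have sq_ge0 : 0 <= \sum_(l < d) (2 * rho + C1) ^+ 2.
  by apply: sumr_ge0 => l _; exact: sqr_ge0.
have [C2 [C2_gt0 C2E]] := expr_fact_le_geometric (mulr_ge0 eta0 sq_ge0).
(* The first summand comes from a difference of squares, with factors at most [C1 * 2 ^- N] and
   [4 * rho + C1]; [C2] pays for the truncated series. *)
exists (eta * \sum_(l < d) C1 * (4 * rho + C1) + C2); split.
  apply: addr_ge0 (ltW C2_gt0); apply: mulr_ge0 => //; apply: sumr_ge0 => l _.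
  by rewrite mulr_ge0// addr_ge0// mulr_ge0.
move=> N y yrho.
have /choice[q qP] : forall l, exists q, poly_degree_le (k * N) q /\
    forall u, l2ball r u -> `|phi u 0 l - q u| <= C1 * 2 ^- N.
  by move=> l; have [q ? ?] := qE N l; exists q.
pose s u := eta * \sum_l (q l u - y 0 l) ^+ 2.
exists (fun u => \sum_(m < N.+1) m`!%:R^-1 * (- s u) ^+ m).
  apply: poly_degree_le_sum => m; apply: poly_degree_leZ.
  apply: (@poly_degree_leW _ _ (m * (2 * (k * N)))).
    by rewrite leq_mul2r -ltnS ltn_ord orbT.
  apply: poly_degree_leX; rewrite /s.
  under eq_fun do rewrite -mulNr; apply: poly_degree_leZ.
  apply: poly_degree_le_sum => l; apply: poly_degree_leX.
  by apply: poly_degree_leD; [exact: (qP l).1|exact: poly_degree_le_cst].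
move=> u ub; set e := 2 ^- N : R.
have e_ge0 : 0 <= e by rewrite invr_ge0 exprn_ge0.
have e_le1 : e <= 1 by rewrite invf_le1 ?exprn_gt0// exprn_ege1// ler1n.
have phil l : `|phi u 0 l| <= rho.
  exact: le_trans (coord_le_l2norm _ _) (phirho _ ub).
have yl l : `|y 0 l| <= rho by exact: le_trans (coord_le_l2norm _ _) yrho.
have ql l := (qP l).2 u ub.
have C1e : C1 * e <= C1 by rewrite ler_piMr.
have s_ge0 : 0 <= s u by rewrite mulr_ge0// sumr_ge0// => l _; exact: sqr_ge0.
have sB : s u <= B.
  apply: ler_wpM2l => //; apply: ler_sum => l _.
  rewrite -(real_normK (num_real (_ - _))) lerXn2r// ?nnegrE ?addr_ge0 ?mulr_ge0//.
  rewrite -(subrK (phi u 0 l) (q l u)) -addrA.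
  have := ql l; have := phil l; have := yl l; have := C1e.
  rewrite distrC -/e => h1 h2 h3 h4.
  have := ler_normD (q l u - phi u 0 l) (phi u 0 l - y 0 l).
  have := ler_normB (phi u 0 l) (y 0 l).
  lra.
have sE : `|eta * l2norm (phi u - y) ^+ 2 - s u| <=
    eta * \sum_(l < d) C1 * (4 * rho + C1) * e.
  rewrite sqr_l2norm /s -mulrBr normrM (ger0_norm eta0) ler_wpM2l//.
  rewrite -sumrB; apply: le_trans (ler_norm_sum _ _ _) _; apply: ler_sum => l _.
  rewrite !mxE subr_sqr normrM [leRHS]mulrAC.
  apply: ler_pM => //.
    by rewrite opprB addrA subrK; exact: ql.
  have := ql l; have := phil l; have := yl l; have := C1e.
  rewrite -/e !ler_norml => h1 /andP[? ?] /andP[? ?] /andP[? ?].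
  apply/andP; split; lra.
rewrite mulNr -(subrKA (expR (- s u))).
apply: le_trans (ler_normD _ _) _; rewrite mulrDl; apply: lerD.
  apply: le_trans (expRN_lipschitz _ s_ge0) _.
    by rewrite mulr_ge0// sqr_ge0.
  by rewrite -mulrA mulr_suml.
apply: le_trans (C2E N).
under eq_bigr do rewrite mulrC.
by apply: expR_taylor_le; rewrite s_ge0.
Qed.

(** * Low-rank approximation of the kernel matrix and the final bound *)

Lemma gaussian_kernel_sym (R : realType) (d n : nat) (eta : R)
    (x : 'I_n -> 'rV[R]_d) : (gaussian_kernel eta x)^T = gaussian_kernel eta x.
Proof.
apply/matrixP => i j; rewrite !mxE !sqr_l2norm; congr (expR (_ * _)).
by apply: eq_bigr => l _; rewrite !mxE -sqrrN opprB.
Qed.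

(** Each point is assigned one chart. Row [i] of the kernel is approximated by polynomials in the
    chart coordinates of [x i], with coefficients depending on the column, so pairs of a chart and
    an exponent index the low-rank factors. *)
Lemma approx_rank_le (R : realType) (d k T : nat) (rho eta Q : R)
    (Omega : set 'rV[R]_d) (U : 'I_T -> set 'rV[R]_d) (r : 'I_T -> R)
    (Psi : 'I_T -> 'rV[R]_d -> 'rV[R]_k)
    (Psi_inv : 'I_T -> 'rV[R]_k -> 'rV[R]_d) :
  0 < rho -> 0 < eta -> 0 < Q -> Omega `<=` l2cball rho ->
  is_atlas Omega U r Psi Psi_inv ->
  (forall (j : 'I_T) (alpha : {ffun 'I_k -> nat}),
       (0 < mdegree alpha)%N ->
       (ereal_sup [set (l2norm (mderiv alpha (Psi_inv j) u))%:E
                  | u in l2ball (r j)] <= (Q ^+ mdegree alpha)%:E)%E) ->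
  exists C : R, 0 <= C /\
    forall (eps : R) (n N : nat) (x : 'I_n -> 'rV[R]_d),
      0 < eps -> (0 < n)%N -> (forall i, Omega (x i)) ->
      approx_rank rho x eta eps <=
        (T * (N * (2 * (k * N))).+1 ^ k)%:R +
        C * n%:R ^+ 2 / eps * 2 ^- N.
Proof.
move=> rho0 eta0 Q0 Orho [Ocov Uopen r0 diffeoE] hbound.
have phiB j (alpha : {ffun 'I_k -> nat}) u : (0 < mdegree alpha)%N ->
    l2ball (r j) u -> l2norm (mderiv alpha (Psi_inv j) u) <= Q ^+ mdegree alpha.
  move=> a0 ub; rewrite -lee_fin; apply: le_trans (hbound j alpha a0).
  by apply: ereal_sup_ubound; exists u.
have phirho j u : l2ball (r j) u -> l2norm (Psi_inv j u) <= rho.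
  move=> ub; have [_ /(_ u ub)[Uu _] _ _] := diffeoE j.
  have [V _ UE] := Uopen j; apply: Orho.
  by move: Uu; rewrite UE => -[].
have /choice[C CP] : forall j, exists C : R, 0 <= C /\
    forall N y, l2norm y <= rho ->
    exists2 P, poly_degree_le (N * (2 * (k * N))) P &
      forall u, l2ball (r j) u ->
        `|expR (- eta * l2norm (Psi_inv j u - y) ^+ 2) - P u| <= C * 2 ^- N.
  move=> j; have [_ _ _ sphi] := diffeoE j.
  by apply: (gaussian_chart_poly_approx (ltW (r0 j)) (ltW Q0) (ltW rho0)
    (ltW eta0) sphi (phiB j) (phirho j)).
have C_ge0 : 0 <= \sum_j C j by apply: sumr_ge0 => j _; have [] := CP j.
pose e4 := expR (4 * eta * rho ^+ 2).
(* This is the constant in [n%:R * delta / tau] for [delta = (\sum_j C j) * 2 ^- N] and the level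
   [tau] of [approx_rank]. *)
exists (2 * e4 * \sum_j C j); split.
  by rewrite mulr_ge0// mulr_ge0// expR_ge0.
move=> eps n N x eps0 n0 xO.
have n0R : 0 < n%:R :> R by rewrite ltr0n.
set D := (N * _)%N.
have /choice[c cx] : forall i, exists j, U j (x i).
  by move=> i; have [j _ Ux] := Ocov _ (xO i); exists j.
pose u i := Psi (c i) (x i).
have ub i : l2ball (r (c i)) (u i) /\ Psi_inv (c i) (u i) = x i.
  by case: (diffeoE (c i)) => + _ _ _; apply.
have /choice[coef coefP] : forall p : 'I_T * 'I_n, exists b : {ffun 'I_k -> 'I_D.+1} -> R,
    forall v, l2ball (r p.1) v ->
      `|expR (- eta * l2norm (Psi_inv p.1 v - x p.2) ^+ 2) -
        \sum_alpha b alpha * \prod_i v 0 i ^+ alpha i| <= C p.1 * 2 ^- N.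
  move=> [j m]; have [_ /(_ N (x m) (Orho _ (xO m)))[P [b bE] PE]] := CP j.
  by exists b => v vb; rewrite /= -bE; exact: PE.
(* The indicator lets only monomials of the chart assigned to [x i] enter row [i]. *)
pose a i (p : 'I_T * {ffun 'I_k -> 'I_D.+1}) : R :=
  (p.1 == c i)%:R * \prod_l u i 0 l ^+ p.2 l.
pose b (p : 'I_T * {ffun 'I_k -> 'I_D.+1}) m : R := coef (p.1, m) p.2.
set tau := eps / (2 * n%:R) * expR (- 4 * eta * rho ^+ 2).
have tau0 : 0 < tau by rewrite mulr_gt0 ?expR_gt0// divr_gt0// mulr_gt0.
have delta0 : 0 <= (\sum_j C j) * 2 ^- N by rewrite mulr_ge0 ?invr_ge0 ?exprn_ge0.
have Ele i m : `|gaussian_kernel eta x i m - \sum_p a i p * b p m| <=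
    (\sum_j C j) * 2 ^- N.
  have [uib xiE] := ub i.
  have -> : \sum_p a i p * b p m =
      \sum_alpha coef (c i, m) alpha * \prod_l u i 0 l ^+ alpha l.
    rewrite -(pair_bigA _ (fun j alpha => a i (j, alpha) * b (j, alpha) m))/=.
    rewrite (bigD1 (c i))//= [X in _ + X]big1 ?addr0.
      by apply: eq_bigr => alpha _; rewrite /a /b/= eqxx mul1r mulrC.
    by move=> j /negPf ji; apply: big1 => alpha _; rewrite /a/= ji !mul0r.
  rewrite mxE -{1}xiE; apply: le_trans (coefP (c i, m) _ uib) _ => /=.
  rewrite ler_wpM2r ?invr_ge0 ?exprn_ge0// (bigD1 (c i))//= lerDl.
  by apply: sumr_ge0 => j _; have [] := CP j.
have psd v := gaussian_kernel_psd x v (ltW eta0).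
have := effective_dim_low_rank (gaussian_kernel_sym eta x) psd tau0 n0 delta0 Ele.
rewrite card_prod card_ffun !card_ord => /le_trans; apply.
rewrite lerD2l /tau.
have -> : - 4 * eta * rho ^+ 2 = - (4 * eta * rho ^+ 2) by ring.
rewrite expRN -/e4 le_eqVlt; apply/orP; left; apply/eqP.
have e40 : e4 != 0 by rewrite gt_eqF ?expR_gt0.
have n0' : n%:R != 0 :> R by rewrite gt_eqF.
have eps0' : eps != 0 by rewrite gt_eqF.
have p20 : 2 ^+ N != 0 :> R by rewrite expf_neq0.
by field; rewrite ?e40 ?n0' ?eps0' ?p20.
Qed.

Theorem corollary4 (R : realType) (d k : nat) (hkd : (k <= d)%N)
    (rho eta : R) (hrho : 0 < rho) (heta : 0 < eta)
    (Omega : set 'rV[R]_d) (hball : Omega `<=` l2cball rho)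
    (hcompact : compact Omega) (hmanifold : smooth_manifold k Omega)
    (T : nat) (U : 'I_T -> set 'rV[R]_d) (r : 'I_T -> R)
    (Psi : 'I_T -> 'rV[R]_d -> 'rV[R]_k)
    (Psi_inv : 'I_T -> 'rV[R]_k -> 'rV[R]_d)
    (hatlas : is_atlas Omega U r Psi Psi_inv)
    (Q : R) (hQ : 0 < Q)
    (hbound : forall (j : 'I_T) (alpha : {ffun 'I_k -> nat}),
       (0 < mdegree alpha)%N ->
       (ereal_sup [set (l2norm (mderiv alpha (Psi_inv j) u))%:E
                  | u in l2ball (r j)] <= (Q ^+ mdegree alpha)%:E)%E) :
  exists c : R, 0 < c /\
    forall (eps : R) (n : nat) (x : 'I_n -> 'rV[R]_d),
      0 < eps -> eps < 1 -> (2 <= n)%N ->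
      injective x -> (forall i, Omega (x i)) ->
      approx_rank rho x eta eps <=
        c * (ln (n%:R / eps)) `^ (5 * k%:R / 2).
Proof.
have [C [C0 rank_le]] := approx_rank_le hrho heta hQ hball hatlas hbound.
pose h : R := ln 2.
have h0 : 0 < h by rewrite ln_gt0// ltr1n.
(* Chosen so that [N%:R <= beta * L] below: the added 1 absorbs the rounding of [N], because
   [1 <= L / h]. *)
pose beta := (2 + C / h + 1) / h.
have beta0 : 0 < beta.
  by rewrite divr_gt0// ltr_wpDl// addr_ge0// divr_ge0// ltW.
(* The first summand bounds the rank; the second pays for the small eigenvalues, whose total is at
   most [1 <= (L / h) ^+ (2 * k)]. *)
pose c1 := T%:R * ((2 * k + 1)%:R * beta ^+ 2) ^+ k + h^-1 ^+ (2 * k).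
have c10 : 0 < c1.
  rewrite ltr_wpDl ?exprn_gt0 ?invr_gt0// mulr_ge0// exprn_ge0//.
  by rewrite mulr_ge0// exprn_ge0// ltW.
(* Since [h <= L], the power [k / 2] of [L / h] is at least 1, which raises the exponent from
   [2 * k] to [5 * k / 2]. *)
exists (c1 / h `^ (k%:R / 2)); split; first by rewrite divr_gt0// powR_gt0.
move=> eps n x eps0 eps1 n2 _ xO.
have n0 : (0 < n)%N by exact: ltn_trans n2.
have ne_gt0 : 0 < n%:R / eps by rewrite divr_gt0// ltr0n.
have le2 : 2 <= n%:R / eps.
  rewrite ler_pdivlMr//; apply: (@le_trans _ _ 2); last by rewrite ler_nat.
  by rewrite ler_piMr// ltW.
set L := ln (n%:R / eps).
have hL : h <= L by rewrite ler_ln ?posrE.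
have L0 : 0 < L by exact: lt_le_trans hL.
(* [N%:R * h] exceeds [(2 + C / h) * L >= 2 * L + C], so [2 ^+ N] dominates [C * n%:R ^+ 2 / eps].
   The successor also gives [1 <= N]. *)
pose N := (Num.truncn ((2 + C / h) / h * L)).+1.
have kL0 : 0 <= (2 + C / h) / h * L.
  by rewrite mulr_ge0 ?(ltW L0)// divr_ge0 ?(ltW h0)// addr_ge0// divr_ge0// ltW.
have N_gt : (2 + C / h) / h * L < N%:R by rewrite truncnS_gt.
have N_le : N%:R <= beta * L.
  rewrite /N -natr1 /beta [in leRHS]mulrDl [leRHS]mulrDl lerD ?truncn_le//.
  by rewrite div1r mulrC ler_pdivlMr// mul1r.
clearbody beta.
apply: le_trans (rank_le eps n N x eps0 n0 xO) _.
apply: (@le_trans _ _ (c1 * L ^+ (2 * k))); last first.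
  have -> : 5 * k%:R / 2 = (2 * k)%:R + k%:R / 2 :> R by rewrite natrM; field.
  rewrite powRD; last by rewrite (gt_eqF L0) implybT.
  rewrite powR_mulrn ?(ltW L0)// -!mulrA ler_wpM2l ?(ltW c10)//.
  rewrite mulrCA ler_peMr ?exprn_ge0 ?(ltW L0)//.
  rewrite mulrC ler_pdivlMr ?powR_gt0// mul1r.
  by rewrite ge0_ler_powR ?nnegrE ?divr_ge0 ?(ltW L0) ?(ltW h0).
rewrite mulrDl; apply: lerD.
  rewrite natrM -mulrA ler_wpM2l// exprM -exprMn natrX lerXn2r ?nnegrE//.
    by rewrite !mulr_ge0 ?exprn_ge0 ?(ltW beta0) ?(ltW L0).
  (* As [1 <= N], the successor is absorbed into [N%:R ^+ 2]. *)
  apply: (@le_trans _ _ ((2 * k + 1)%:R * N%:R ^+ 2)).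
    rewrite -natrX -natrM ler_nat.
    by rewrite mulnDl mul1n -addn1 leq_add// mulnC -!mulnA.
  rewrite -mulrA ler_wpM2l// -exprMn lerXn2r ?nnegrE// mulr_ge0// ltW//.
apply: (@le_trans _ _ 1); last first.
  rewrite -exprMn exprn_ege1// mulrC ler_pdivlMr// mul1r.
  exact: hL.
rewrite ler_pdivrMr ?exprn_gt0// mul1r.
have -> : 2 ^+ N = expR (N%:R * h) :> R.
  by rewrite expRM_natl lnK ?posrE.
(* Here [C <= expR C], and [n%:R ^+ 2 / eps <= (n%:R / eps) ^+ 2 = expR (2 * L)] as [eps < 1]. *)
apply: (@le_trans _ _ (expR (C + 2 * L))).
  rewrite expRD -mulrA; apply: ler_pM => //.
  - by rewrite divr_ge0// ?exprn_ge0// ltW.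
  - by apply: le_trans (expR_ge1Dx _); rewrite lerDr.
  rewrite expRM_natl lnK ?posrE// expr_div_n ler_pM2l ?exprn_gt0 ?ltr0n//.
  by rewrite lef_pV2 ?posrE ?exprn_gt0// expr2 ler_piMr// ltW.
rewrite ler_expR; apply: (@le_trans _ _ ((2 + C / h) * L)).
  rewrite [leRHS]mulrDl [leLHS]addrC lerD2l mulrAC ler_pdivlMr// ler_wpM2l//.
by rewrite -ler_pdivrMr// mulrAC ltW.
Qed.
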